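(* Let $a,b,c\in R^{WD}$ commute with each other (that is, $ab=ba$, $ac=ca$, $bc=cb$), and let $a^{WD}$, $b^{WD}$, $c^{WD}$ be WD inverses of $a,b,c$ respectively. If $aa^{WD}b=baa^{WD}$ and $a^{WD}b^{WD}c=ca^{WD}b^{WD}$, then $abc$ is WD invertible and $a^{WD}b^{WD}c^{WD}$ is a WD inverse of $abc$, i.e. $(abc)^{WD}=a^{WD}b^{WD}c^{WD}$.
   Context: $R$ is a proper unital ring with involution: an associative ring with $1$ and a map $*:R\to R$ with $(a+b)^*=a^*+b^*$, $(ab)^*=b^*a^*$, $(a^* )^*=a$, such that $a^*a=0$ implies $a=0$. Weak Drazin (WD) inverse: $a\in R$ is WD invertible if there are $x\in R$ and a positive integer $k$ with $axa=a$, $a^{k+1}x=a^k$, $xa^{k+1}=a^k$. The least positive integer $k$ for which such an $x$ exists is the weak Drazin index $\mathrm{ind}(a)$; any $x$ satisfying the three equations with $k=\mathrm{ind}(a)$ is a WD inverse of $a$ (not unique in general), denoted $a^{WD}$. $R^{WD}$ is the set of WD invertible elements. *)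

(* Defs.v *)
From HB Require Import structures.
From mathcomp Require Import all_boot all_order all_algebra.

Set Implicit Arguments.
Unset Strict Implicit.
Unset Printing Implicit Defensive.

Import GRing.Theory.
Local Open Scope ring_scope.

Record proper_involution (R : pzRingType) (star : R -> R) : Prop := {
  starD : {morph star : a b / a + b};
  starM : forall a b : R, star (a * b) = star b * star a;
  starK : involutive star;
  star_proper : forall a : R, star a * a = 0 -> a = 0
}.

Definition WD_equations (R : pzRingType) (a x : R) (k : nat) : Prop :=
  [/\ a * x * a = a, a ^+ k.+1 * x = a ^+ k & x * a ^+ k.+1 = a ^+ k].

Definition WD_invertible (R : pzRingType) (a : R) : Prop :=
  exists (x : R) (k : nat), (0 < k)%N /\ WD_equations a x k.

(* [is_WD_index a k] means that ind(a) is defined and equal to k. *)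
Definition is_WD_index (R : pzRingType) (a : R) (k : nat) : Prop :=
  [/\ (0 < k)%N,
      exists x : R, WD_equations a x k
    & forall j : nat, (0 < j)%N -> (exists x : R, WD_equations a x j) ->
        (k <= j)%N].

(* WD inverses are not unique, hence a relation rather than a function; the
   equations are required at the least possible exponent, k = ind(a). *)
Definition is_WD_inverse (R : pzRingType) (a x : R) : Prop :=
  exists k : nat, is_WD_index a k /\ WD_equations a x k.

(* Main.v *)
(* The equations pass from exponent k to any larger one, and back down to any
   exponent at which the element has some solution, in particular to its index.
   Hence it suffices to verify the equations for the product at one common
   exponent k >= ind(a), ind(b), ind(c), where they follow from
   (abc)^k = a^k b^k c^k and from the facts that a aWD commutes with b and
   aWD bWD commutes with c. *)
Require Import Defs.
From Stdlib Require Import Classical.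
From HB Require Import structures.
From mathcomp Require Import all_boot all_order all_algebra.

Set Implicit Arguments.
Unset Strict Implicit.
Unset Printing Implicit Defensive.

Import GRing.Theory.
Local Open Scope ring_scope.

Lemma WD_equationsW (R : pzRingType) (a x : R) (k m : nat) :
  (k <= m)%N -> WD_equations a x k -> WD_equations a x m.
Proof.
move=> /subnK <-; move: (m - k)%N => d [axa ax xa]; split=> //.
  by rewrite -addnS exprD -mulrA ax -exprD.
by rewrite addnC -addSn exprD mulrA xa -exprD.
Qed.

(* [a ^+ k = a ^+ (d + k) * y ^+ d = y ^+ d * a ^+ (d + k)] turns the equations
   for [x] at exponent [d + k] into those at [k]. *)
Lemma WD_equations_descend (R : pzRingType) (a x y : R) (k m : nat) :
  WD_equations a y k -> WD_equations a x m -> WD_equations a x k.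
Proof.
move=> [_ ay ya] Ex.
have [mk|/ltnW km] := leqP m k; first exact: WD_equationsW Ex.
move: Ex; rewrite -(subnK km); move: (m - k)%N => d [axa ax xa].
have akr : a ^+ k = a ^+ (d + k) * y ^+ d.
  elim: d {ax xa} => [|d IHd]; first by rewrite mulr1.
  by rewrite exprS mulrA addSnnS exprD -(mulrA (a ^+ d)) ay -exprD.
have akl : a ^+ k = y ^+ d * a ^+ (d + k).
  elim: d {ax xa akr} => [|d IHd]; first by rewrite mul1r.
  by rewrite exprSr -mulrA addSnnS addnC exprD (mulrA y) ya -exprD addnC.
split=> //.
  by rewrite exprSr akl -(mulrA (y ^+ d)) -exprSr -mulrA ax.
by rewrite exprS akr (mulrA a) -exprS mulrA xa.
Qed.

(** Solvability at [k] forces a least solvable exponent [j], witnessed by some [y]; descending along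
    [y] brings [x] itself down to [j]. *)
Lemma is_WD_inverseP (R : pzRingType) (a x : R) (k : nat) :
  (0 < k)%N -> WD_equations a x k -> is_WD_inverse a x.
Proof.
move=> k_gt0 Ex.
pose P j := (0 < j)%N /\ exists y, WD_equations a y j.
have [j [[j_gt0 [y Ey]] j_min]] :
    exists j, P j /\ forall i, P i -> (j <= i)%N.
  have: P k by split=> //; exists x.
  (* [P] is not decidable, so the minimum comes from strong induction and excluded middle. *)
  elim/ltn_ind: k {k_gt0 Ex} => k IHk Pk.
  case: (classic (exists2 i, (i < k)%N & P i)) => [[i]|no_lt].
    exact: IHk.
  exists k; split=> // i Pi; rewrite leqNgt; apply/negP => ik.
  by apply: no_lt; exists i.
exists j; split; last exact: WD_equations_descend Ey Ex.
by split=> // [|i i_gt0 Hi]; [exists y | apply: j_min].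
Qed.

Lemma WD_equations_mul3 (R : pzRingType) (a b c x y z : R) (k : nat) :
  a * b = b * a -> a * c = c * a -> b * c = c * b ->
  a * x * b = b * a * x -> x * y * c = c * x * y ->
  WD_equations a x k -> WD_equations b y k -> WD_equations c z k ->
  WD_equations (a * b * c) (x * y * z) k.
Proof.
move=> ab ac bc axb xyc [axa ax xa] [byb bY yb] [czc cz zc].
have cab : GRing.comm c (a * b) by apply: commrM.
have cxy : GRing.comm c (x * y) by rewrite /GRing.comm mulrA.
have bax : GRing.comm b (a * x) by rewrite /GRing.comm mulrA.
have powE n : (a * b * c) ^+ n = a ^+ n * b ^+ n * c ^+ n.
  by rewrite exprMn_comm ?exprMn_comm //; apply/commr_sym.
split.
(* With both [a * b] turned into [b * a], moving [b] past [a * x] gives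
   [a x (b y b) a = a x a b]. *)
- have abxyab : a * b * (x * y) * (a * b) = a * b.
    rewrite {1}ab {1}ab !mulrA -(mulrA b) bax -!mulrA (mulrA b) (mulrA (b * y)).
    by rewrite byb -ab !mulrA axa.
  (* The left [c] moves past [x * y] and the right one past [a * b], so that they enclose [z]. *)
  rewrite -{2}cab -(mulrA (a * b) c) (mulrA c (x * y)) cxy.
  rewrite (mulrA _ c (a * b)) -(mulrA (a * b) _ c) -2!(mulrA (x * y)) czc.
  rewrite (mulrA (a * b) (x * y) c) -(mulrA _ c) cab.
  by rewrite (mulrA _ (a * b) c) abxyab.
(* Only the product [a * x] is known to commute with [b], so one factor [a] is split off and travels
   next to [x]. *)
- have abx : a ^+ k.+1 * b ^+ k.+1 * x = a ^+ k * b ^+ k.+1.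
    have bXa : GRing.comm (b ^+ k.+1) a by apply/commr_sym/commrX.
    have bXax : GRing.comm (b ^+ k.+1) (a * x) by apply/commr_sym/commrX/commr_sym.
    by rewrite exprSr -(mulrA (a ^+ k)) -bXa -!mulrA bXax !mulrA -exprSr ax.
  have cXxy : GRing.comm (c ^+ k.+1) (x * y) by apply/commr_sym/commrX/commr_sym.
  rewrite !powE -(mulrA _ (c ^+ _)) (mulrA (c ^+ _)) cXxy -(mulrA (x * y)) cz.
  by rewrite !mulrA abx -(mulrA (a ^+ k)) bY.
- have cXxy : GRing.comm (c ^+ k) (x * y) by apply/commr_sym/commrX/commr_sym.
  have aXbX i j : GRing.comm (a ^+ i) (b ^+ j).
    by apply: commrX; apply/commr_sym/commrX.
  have cXabX i : GRing.comm (c ^+ i) (a ^+ k.+1 * b ^+ k.+1).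
    by apply/commr_sym/commrX/commr_sym/commrM; apply: commrX; apply/commr_sym.
  have cXabX' : GRing.comm (c ^+ k) (a ^+ k * b ^+ k).
    by apply: commrM; apply: commrX; apply/commr_sym/commrX.
  (* The powers are reordered so that [z], [y], [x] meet those of [c], [b], [a] in turn; the
     remaining [c ^+ k] leaves to the left past [x * y]. *)
  rewrite !powE -cXabX mulrA -(mulrA (x * y)) zc -cXxy -cXabX' -!mulrA.
  by rewrite [a ^+ _ * _]aXbX (mulrA y) yb -aXbX (mulrA x) xa.
Qed.

Theorem theorem3p6 (R : pzRingType) (star : R -> R)
    (Hstar : proper_involution star)
    (a b c aWD bWD cWD : R)
    (Ha : WD_invertible a) (Hb : WD_invertible b) (Hc : WD_invertible c)
    (Hab : a * b = b * a) (Hac : a * c = c * a) (Hbc : b * c = c * b)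
    (HaWD : is_WD_inverse a aWD)
    (HbWD : is_WD_inverse b bWD)
    (HcWD : is_WD_inverse c cWD)
    (H1 : a * aWD * b = b * a * aWD)
    (H2 : aWD * bWD * c = c * aWD * bWD) :
  WD_invertible (a * b * c) /\ is_WD_inverse (a * b * c) (aWD * bWD * cWD).
Proof.
have [ka [[ka_gt0 _ _] Ea]] := HaWD.
have [kb [_ Eb]] := HbWD.
have [kc [_ Ec]] := HcWD.
(* Any common upper bound of the three exponents would serve. *)
pose k := (ka + (kb + kc))%N.
have k_gt0 : (0 < k)%N by rewrite addn_gt0 ka_gt0.
have E : WD_equations (a * b * c) (aWD * bWD * cWD) k.
  apply: WD_equations_mul3 => //.
  - by apply: WD_equationsW Ea; rewrite leq_addr.
  - by apply: WD_equationsW Eb; rewrite /k addnCA leq_addr.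
  - by apply: WD_equationsW Ec; rewrite /k addnA leq_addl.
split; last exact: is_WD_inverseP E.
by exists (aWD * bWD * cWD), k.
Qed.
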